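(* Let $\alpha\neq -1,-2,\ldots$ be a real number and let $\mathcal F=(F_1,F_2)$ be a pair of finite sets of positive integers (not both empty). Then the polynomials $L_n^{\alpha;\mathcal F}$, $n\in\sigma_{\mathcal F}$, are common eigenfunctions of the second order differential operator $$D_{\mathcal F}=x\,\partial^2+h_1(x)\,\partial+h_0(x),\qquad \partial=\frac{d}{dx},$$ where, with $\Omega_{\mathcal F}=\Omega_{\mathcal F}^\alpha$, $$h_1(x)=\alpha+k+1-x-2x\frac{\Omega_{\mathcal F}'(x)}{\Omega_{\mathcal F}(x)},$$ $$h_0(x)=-k_1-u_{\mathcal F}+(x-\alpha-k)\frac{\Omega_{\mathcal F}'(x)}{\Omega_{\mathcal F}(x)}+x\frac{\Omega_{\mathcal F}''(x)}{\Omega_{\mathcal F}(x)}.$$ More precisely, $D_{\mathcal F}(L_n^{\alpha;\mathcal F})=-n\,L_n^{\alpha;\mathcal F}$ for all $n\in\sigma_{\mathcal F}$.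
   Context: Laguerre polynomials: $L_n^\alpha(x)=\sum_{j=0}^n\frac{(-x)^j}{j!}\binom{n+\alpha}{n-j}$. For a pair $\mathcal F=(F_1,F_2)$ of finite sets of positive integers, let $k_i=|F_i|$, $k=k_1+k_2$, $$u_{\mathcal F}=\sum_{f\in F_1}f+\sum_{f\in F_2}f-\binom{k_1+1}{2}-\binom{k_2}{2},\qquad \sigma_{\mathcal F}=\{u_{\mathcal F},u_{\mathcal F}+1,\ldots\}\setminus\{u_{\mathcal F}+f: f\in F_1\}.$$ For $n\in\sigma_{\mathcal F}$, $L_n^{\alpha;\mathcal F}(x)$ is the determinant of the $(k+1)\times(k+1)$ matrix with columns indexed by $j=0,1,\ldots,k$ whose rows are, from top to bottom: the row $\big((L_{n-u_{\mathcal F}}^\alpha)^{(j)}(x)\big)_j$; then, for each $f\in F_1$ in increasing order, the row $\big((L_f^\alpha)^{(j)}(x)\big)_j$; then, for each $f\in F_2$ in increasing order, the row $\big(L_f^{\alpha+j}(-x)\big)_j$. Here $^{(j)}$ denotes the $j$-th derivative. $\Omega_{\mathcal F}^\alpha(x)$ is the determinant of the $k\times k$ matrix with columns indexed by $j=0,\ldots,k-1$ whose rows are $\big((L_f^\alpha)^{(j)}(x)\big)_j$ for $f\in F_1$ (increasing order), followed by $\big(L_f^{\alpha+j}(-x)\big)_j$ for $f\in F_2$ (increasing order). *)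

(* Defs.v *)
From HB Require Import structures.
From mathcomp Require Import all_boot all_order all_algebra.
From mathcomp Require Import finmap reals.

Set Implicit Arguments.
Unset Strict Implicit.
Unset Printing Implicit Defensive.

Import GRing.Theory.

Local Open Scope ring_scope.

Notation "p %:F" := (@FracField.tofrac _ p) : ring_scope.

(* a (a - 1) ... (a - m + 1) / m! *)
Definition rbinom (R : realType) (a : R) (m : nat) : R :=
  (\prod_(i < m) (a - i%:R)) / (m`!)%:R.

Definition laguerre (R : realType) (a : R) (n : nat) : {poly R} :=
  \sum_(j < n.+1) ((j`!)%:R^-1 * rbinom (n%:R + a) (n - j)) *: (- 'X) ^+ j.

Definition fpair := ({fset nat} * {fset nat})%type.

Definition kF (F : fpair) : nat := (#|` F.1| + #|` F.2|)%N.

(* For sets of positive integers the sums dominate the binomials, so the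
   truncated subtractions are exact. *)
Definition uF (F : fpair) : nat :=
  (\sum_(f <- F.1) f + \sum_(f <- F.2) f
     - 'C(#|` F.1|.+1, 2) - 'C(#|` F.2|, 2))%N.

Definition sigmaF (F : fpair) : pred nat :=
  [pred n | (uF F <= n)%N && (n \notin [fset (uF F + f)%N | f in F.1]%fset)].

(* A matrix row is given as a function of its column index. *)
Definition det_rows (R : realType) (m : nat) (rows : seq (nat -> {poly R})) :
    {poly R} :=
  \det (\matrix_(i < m, j < m) nth (fun=> 0) rows i j).

Definition wronskian_row (R : realType) (a : R) (n : nat) : nat -> {poly R} :=
  fun j => (laguerre a n)^`(j).

Definition shifted_row (R : realType) (a : R) (f : nat) : nat -> {poly R} :=
  fun j => laguerre (a + j%:R) f \Po (- 'X).

(* finmap does not enumerate a set in increasing order, hence the sort *)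
Definition rowsF (R : realType) (a : R) (F : fpair) : seq (nat -> {poly R}) :=
  [seq wronskian_row a f | f <- sort leq F.1] ++
  [seq shifted_row a f | f <- sort leq F.2].

Definition OmegaF (R : realType) (a : R) (F : fpair) : {poly R} :=
  det_rows (kF F) (rowsF a F).

Definition laguerreF (R : realType) (a : R) (F : fpair) (n : nat) : {poly R} :=
  det_rows (kF F).+1 (wronskian_row a (n - uF F) :: rowsF a F).

Definition h1 (R : realType) (a : R) (F : fpair) : {fraction {poly R}} :=
  let Om := OmegaF a F in
  ((a + (kF F)%:R + 1)%:P - 'X)%:F
    - 2%:R * 'X%:F * ((Om^`())%:F / Om%:F).

Definition h0 (R : realType) (a : R) (F : fpair) : {fraction {poly R}} :=
  let Om := OmegaF a F in
  ((- (#|` F.1|)%:R - (uF F)%:R)%:P)%:F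
    + ('X - (a + (kF F)%:R)%:P)%:F * ((Om^`())%:F / Om%:F)
    + 'X%:F * ((Om^`(2))%:F / Om%:F).

Definition DF (R : realType) (a : R) (F : fpair) (p : {poly R}) :
    {fraction {poly R}} :=
  'X%:F * (p^`(2))%:F + h1 a F * (p^`())%:F + h0 a F * p%:F.

Definition is_eigenfunction (R : realType)
    (D : {poly R} -> {fraction {poly R}}) (lambda : R) (p : {poly R}) : Prop :=
  p != 0 /\ D p = (lambda *: p)%:F.

(* Main.v *)
(* Up to the factor [e^(k2 x)], [OmegaF] and [laguerreF] are Wronskians of
   eigenfunctions [L_f] (eigenvalue [-f]) and [e^x L_f(-x)] (eigenvalue
   [alpha + 1 + f]) of the single operator [T = x d^2 + (alpha + 1 - x) d].
   Crum's theorem then gives the equation: expanding [laguerreF] along the row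
   of [y = L_(n-u)] writes it as [S y], with [S] a differential operator of
   order [k] annihilating the other [k] functions; the coefficients [h1] and [h0]
   are those for which [Omega ((D_F + u) S - S T)] has order less than [k], and since
   it annihilates [k] functions with nonzero Wronskian it vanishes.
   The Wronskians are nonzero because the eigenvalues are pairwise distinct,
   which is where the hypothesis on [alpha] is used. *)

Require Import Defs.
From mathcomp Require Import all_boot all_order all_algebra.
From mathcomp Require Import finmap reals.
From mathcomp Require Import perm ring.

Set Implicit Arguments.
Unset Strict Implicit.
Unset Printing Implicit Defensive.

Import GRing.Theory Num.Theory.

Local Open Scope ring_scope.

(** * Derivatives and kernels of polynomial determinants *)

Lemma deriv_prod (R : comNzRingType) (I : finType) (F : I -> {poly R}) :
  (\prod_i F i)^`() = \sum_l (F l)^`() * \prod_(i | i != l) F i.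
Proof.
suff: forall r : seq I, uniq r -> (\prod_(i <- r) F i)^`() =
    \sum_(l <- r) (F l)^`() * \prod_(i <- r | i != l) F i.
  by move/(_ _ (index_enum_uniq I)).
elim=> [_|a r IH /= /andP[ar ur]]; first by rewrite !big_nil derivC.
rewrite !big_cons derivM IH // eqxx /=; congr (_ * _ + _).
  rewrite big_seq_cond [RHS]big_seq_cond; apply: eq_bigl => i.
  by rewrite andbT; case: eqVneq => [->|]; rewrite ?andbT // (negPf ar).
rewrite big_distrr /= !big_seq; apply: eq_bigr => l lr.
by rewrite big_cons ifT; [rewrite mulrCA | apply: contraNneq ar => ->].
Qed.

(** Leibniz's rule differentiates one row at a time, and the cofactors along that row do not see the
    change. *)
Lemma deriv_det (R : comNzRingType) n (M : 'M[{poly R}]_n) :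
  (\det M)^`() = \sum_i \sum_j (M i j)^`() * cofactor M i j.
Proof.
have detE l : \sum_j (M l j)^`() * cofactor M l j =
    \det (\matrix_(i, j) if i == l then (M i j)^`() else M i j).
  rewrite (expand_det_row _ l); apply: eq_bigr => j _.
  rewrite mxE eqxx; congr (_ * (_ * \det _)); apply/matrixP => i j'.
  by rewrite !mxE eq_sym (negPf (neq_lift _ _)).
rewrite (eq_bigr _ (fun i _ => detE i)) exchange_big /= raddf_sum.
apply: eq_bigr => s _; rewrite -big_distrr /=.
have -> : \sum_l \prod_i (\matrix_(i, j) if i == l then (M i j)^`() else M i j)
    i (s i) = (\prod_i M i (s i))^`().
  rewrite deriv_prod; apply: eq_bigr => l _; rewrite (bigD1 l) //= mxE eqxx.
  by congr (_ * _); apply: eq_bigr => i /negPf il; rewrite mxE il.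
by case: (odd_perm s); rewrite ?expr1 ?expr0 ?mulN1r ?mul1r ?derivN.
Qed.

Lemma det_neq0_row_free (R : idomainType) n (M : 'M[R]_n) (v : 'I_n -> R) :
  \det M != 0 -> (forall j, \sum_i v i * M i j = 0) -> forall i, v i = 0.
Proof.
move=> M0 vM i; have [//|vi0] := eqVneq (v i) 0.
case/negP: M0; apply/det0P; exists (\row_i v i).
  by apply: contraNneq vi0 => /rowP/(_ i); rewrite !mxE => ->.
apply/rowP => j; rewrite !mxE -[RHS](vM j).
by apply: eq_bigr => l _; rewrite mxE.
Qed.

Lemma det_neq0_col_free (R : idomainType) n (M : 'M[R]_n) (v : 'I_n -> R) :
  \det M != 0 -> (forall i, \sum_j v j * M i j = 0) -> forall j, v j = 0.
Proof.
rewrite -det_tr => M0 vM; apply: det_neq0_row_free M0 _ => i.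
by rewrite -[RHS](vM i); apply: eq_bigr => j _; rewrite mxE.
Qed.

(** * Jets of eigenfunctions and nonvanishing of their Wronskians *)

(* The sequence [r] stands for the successive derivatives of [e^(c x) r 0],
   each stripped of the factor [e^(c x)]; the second clause says that
   [e^(c x) r 0] is an eigenfunction of [x d^2 + (a + 1 - x) d], and is that
   equation differentiated [j] times. *)
Definition eigenjet (R : nzRingType) (a c lam : R) (r : nat -> {poly R}) :=
  (forall j, r j.+1 = (r j)^`() + c%:P * r j) /\
  (forall j, 'X * r j.+2 + ((a + 1 + j%:R)%:P - 'X) * r j.+1
     = (lam + j%:R)%:P * r j).

(** Apply d + c, which shifts the jet, to equation [j]: differentiating x raises [a + 1 + j], and
    differentiating -x produces the term that raises [lam + j]. *)
Lemma eigenjet_from0 (R : comNzRingType) (a c lam : R) (r : nat -> {poly R}) :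
    (forall j, r j.+1 = (r j)^`() + c%:P * r j) ->
    'X * r 2 + ((a + 1)%:P - 'X) * r 1 = lam%:P * r 0 ->
  eigenjet a c lam r.
Proof.
move=> rS r0; split=> //; elim=> [|j IH]; first by rewrite !addr0.
have dr i : (r i)^`() = r i.+1 - c%:P * r i by rewrite rS addrK.
have dIH := congr1 deriv IH.
rewrite !(derivM, derivD, derivN, derivX, derivC) !dr in dIH.
have /= E := f_equal2 (fun u v => u + c%:P * v + r j.+1) dIH IH.
by apply: (etrans _ (etrans E _)); rewrite -natr1; ring.
Qed.

Notation jets_mx phi n := (\matrix_(i < n, j < n) phi (i : nat) (j : nat)).

(* A linear relation between the rows extends, by differentiation, to one more
   column; the differential equation then applies to it, and subtracting
   [lam n] times the relation eliminates its last term. *)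
Lemma det_eigenjets_neq0 (R : idomainType) (a : R) (c lam : nat -> R)
    (phi : nat -> nat -> {poly R}) n :
    (forall i, (i < n)%N -> eigenjet a (c i) (lam i) (phi i)) ->
    (forall i, (i < n)%N -> phi i 0 != 0) ->
    {in [pred i | (i < n)%N] &, injective lam} ->
  \det (jets_mx phi n) != 0.
Proof.
elim: n => [|n IH] jet nz linj; first by rewrite det_mx00 oner_eq0.
have {IH}dn0 : \det (jets_mx phi n) != 0.
  apply: IH => [i /ltnW|i /ltnW|i j in_ jn]; [exact: jet|exact: nz|].
  by apply: linj; exact: ltnW.
apply/negP => /det0P[u u0 uM]; pose v i := u 0 i.
pose S j := \sum_(i < n.+1) v i * phi i j.
have S0 j : (j <= n)%N -> S j = 0.
  move=> jn; move/rowP/(_ (Ordinal (jn : j < n.+1)%N)) : uM.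
  by rewrite !mxE => uM; rewrite -[RHS]uM; apply: eq_bigr => i _; rewrite mxE.
pose W i := widen_ord (leqnSn n) i; pose m : 'I_n.+1 := ord_max.
have free (w : 'I_n -> {poly R}) :
    (forall j, (j < n)%N -> \sum_i w i * phi i j = 0) -> forall i, w i = 0.
  move=> w0; apply: det_neq0_row_free dn0 _ => j.
  by rewrite -[RHS](w0 j) //; apply: eq_bigr => i _; rewrite mxE.
have q0 : v m != 0.
  apply: contraNneq u0 => vm0; apply/eqP/rowP => i; rewrite mxE.
  suff vW : forall i, v (W i) = 0.
    case: (unliftP m i) => [i' ->|-> //].
    rewrite -[RHS](vW i') /v; congr (u 0 _); apply: val_inj => /=.
    by rewrite /bump leqNgt ltn_ord.
  apply: free => j jn; rewrite -[RHS](S0 j) 1?ltnW // /S big_ord_recr /=.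
  by rewrite -/m vm0 mul0r addr0.
(* The derivative of [v i * phi i j] is [w i * phi i j + v i * phi i j.+1]. *)
pose w (i : 'I_n.+1) := (v i)^`() - (c i)%:P * v i.
pose T j := \sum_(i < n.+1) w i * phi i j.
have dS j : (S j)^`() = T j + S j.+1.
  rewrite /S /T raddf_sum -big_split; apply: eq_bigr => i _ /=.
  by rewrite (jet i _).1 // derivM /w; ring.
have T0 j : (j < n)%N -> T j = 0.
  move=> jn; have := dS j; rewrite !S0 ?(ltnW jn) //.
  by rewrite linear0 addr0.
(* [v] and [w] are both relations on the columns below [n]; eliminating the last row leaves a
   relation between independent rows. So [w] is proportional to [v], and [T n] vanishes because
   [S n] does. *)
have wv (i : 'I_n) : v m * w (W i) - w m * v (W i) = 0.
  move: i; apply: free => j jn.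
  have := S0 j (ltnW jn); have := T0 j jn; rewrite /S /T !big_ord_recr /=.
  move=> /(congr1 ( *%R (v m))) Tj /(congr1 ( *%R (w m))) Sj.
  rewrite -[RHS](subrr 0) -[X in _ = X - _](mulr0 (v m)).
  rewrite -[X in _ = _ - X](mulr0 (w m)).
  rewrite -Tj -Sj !mulrDr !big_distrr /=.
  rewrite [RHS](_ : _ = \sum_(i < n) v m * (w (W i) * phi i j) -
    \sum_(i < n) w m * (v (W i) * phi i j)); last by rewrite /m /W; ring.
  by rewrite -sumrB; apply: eq_bigr => i _; ring.
have Sn1 : S n.+1 = 0.
  have : v m * T n - w m * S n = 0.
    rewrite /T /S !big_ord_recr /= !mulrDr !big_distrr /=.
    rewrite [LHS](_ : _ = \sum_(i < n) v m * (w (W i) * phi i n) -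
      \sum_(i < n) w m * (v (W i) * phi i n)); last by rewrite /m /W; ring.
    rewrite -sumrB big1 // => i _.
    by rewrite !mulrA -mulrBl wv mul0r.
  rewrite S0 // mulr0 subr0 => /eqP; rewrite mulf_eq0 (negPf q0) /= => /eqP Tn.
  by have := dS n; rewrite S0 // linear0 Tn add0r.
have {S0 Sn1}S0 j : (j <= n.+1)%N -> S j = 0.
  by rewrite leq_eqVlt => /predU1P[->|/S0].
(* For [j < n] the differential equation reaches column [j.+2], at most [n.+1]: hence the extra
   column. *)
have lv (i : 'I_n) : (lam i - lam n)%:P * v (W i) = 0.
  move: i; apply: free => j jn.
  have E : \sum_(i < n.+1) (lam i + j%:R)%:P * (v i * phi i j) = 0.
    rewrite -[RHS](_ : 'X * S j.+2 + ((a + 1 + j%:R)%:P - 'X) * S j.+1 = 0).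
      rewrite /S !big_distrr -big_split; apply: eq_bigr => i _ /=.
      by rewrite mulrCA -(jet i _).2 //; ring.
    by rewrite !S0 ?mulr0 ?addr0 // ltnW.
  have : \sum_(i < n.+1) (lam i - lam n)%:P * (v i * phi i j) = 0.
    rewrite -[RHS](subrr 0) -[X in _ = X - _]E.
    rewrite -[X in _ = _ - X](mulr0 (lam n + j%:R)%:P).
    rewrite -[X in _ * X](S0 j) 1?ltnW 1?ltnW // /S big_distrr -sumrB /=.
    by apply: eq_bigr => i _; ring.
  rewrite big_ord_recr /= subrr mul0r addr0 => E'; rewrite -[RHS]E'.
  by apply: eq_bigr => i _; rewrite mulrA.
have vW i : v (W i) = 0.
  have /eqP := lv i; rewrite mulf_eq0 => /orP[|/eqP //].
  rewrite polyC_eq0 subr_eq0 => /eqP /linj; rewrite !inE ltnSn ltnW ?ltnS //.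
  by move=> /(_ erefl erefl) ni; have := ltn_ord i; rewrite ni ltnn.
have := S0 0 isT; rewrite /S big_ord_recr /= big1 => [|i _]; last first.
  by have := vW i; rewrite /W => ->; rewrite mul0r.
by move/eqP; rewrite add0r mulf_eq0 (negPf q0) (negPf (nz n _)).
Qed.

(** * Expansion of a bordered Wronskian *)

Definition bordered (R : Type) (y : nat -> R) (phi : nat -> nat -> R) i :=
  if i is i'.+1 then phi i' else y.

(* Abel's identity: differentiating column [j] of a Wronskian duplicates column
   [j.+1], unless [j] is the last one. *)
Lemma deriv_det_jets (R : comNzRingType) (c : nat -> R)
    (phi : nat -> nat -> {poly R}) n :
    (forall i j, (i < n.+1)%N -> phi i j.+1 = (phi i j)^`() + (c i)%:P * phi i j) ->
  (\det (jets_mx phi n.+1))^`() + (\sum_(i < n.+1) c i)%:P * \det (jets_mx phi n.+1)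
  = \det (\matrix_(i < n.+1, j < n.+1) phi i (bump n j)).
Proof.
move=> phiS; set M := jets_mx phi n.+1.
have colE (j : 'I_n.+1) : \sum_(i < n.+1) phi i j.+1 * cofactor M i j =
    \det (\matrix_(i < n.+1, l < n.+1) phi i (if l == j then j.+1 else l)).
  rewrite (expand_det_col _ j); apply: eq_bigr => i _.
  rewrite mxE eqxx; congr (_ * (_ * \det _)); apply/matrixP => i' l.
  by rewrite !mxE eq_sym (negPf (neq_lift _ _)).
rewrite deriv_det raddf_sum /= mulr_suml -big_split /=.
transitivity (\sum_(i < n.+1) \sum_(j < n.+1) phi i j.+1 * cofactor M i j).
  apply: eq_bigr => i _; rewrite (expand_det_row _ i) big_distrr -big_split /=.
  by apply: eq_bigr => j _; rewrite !mxE phiS //; ring.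
rewrite exchange_big /= big_ord_recr /= big1 ?add0r => [|j _].
  rewrite (colE ord_max); congr (\det _); apply/matrixP => i l; rewrite !mxE.
  congr (phi i _); rewrite /bump; case: eqVneq => [->|]; first by rewrite leqnn.
  by move=> lm; rewrite leqNgt ltn_neqAle lm -ltnS ltn_ord.
rewrite (colE (widen_ord _ j)) -det_tr.
apply: (determinant_alternate (i1 := widen_ord (leqnSn n) j) (i2 := lift ord0 j)).
  by apply/eqP => /(congr1 val) /= /eqP; rewrite /bump /= ltn_eqF.
by move=> i; rewrite !mxE eqxx; congr (phi i _); case: eqP.
Qed.

(** Expansion along the top row, with the sign chosen to make [D] the leading coefficient. Crum's
    argument needs only the two top coefficients explicitly; the second comes from Abel's
    identity. *)
Lemma det_bordered (R : comNzRingType) (c : nat -> R)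
    (phi : nat -> nat -> {poly R}) n (D := \det (jets_mx phi n.+1)) :
    (forall i j, (i < n.+1)%N -> phi i j.+1 = (phi i j)^`() + (c i)%:P * phi i j) ->
  exists s : nat -> {poly R},
    [/\ s n.+1 = D, s n = - (D^`() + (\sum_(i < n.+1) c i)%:P * D) &
     forall y, \det (jets_mx (bordered y phi) n.+2)
       = (-1) ^+ n.+1 * \sum_(j < n.+2) s j * y j].
Proof.
move=> phiS; pose M y : 'M[{poly R}]_n.+2 := jets_mx (bordered y phi) n.+2.
(* Cofactors of the top row ignore its entries, so a zero row serves for every [y]. *)
pose s j := (-1) ^+ n.+1 * cofactor (M (fun=> 0)) ord0 (inord j); exists s.
have sE (j : 'I_n.+2) : s j = (-1) ^+ (n.+1 + j) *
    \det (\matrix_(i < n.+1, l < n.+1) phi i (bump j l)).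
  rewrite /s inord_val /cofactor mulrA -exprD /=; congr (_ * \det _).
  by apply/matrixP => i l; rewrite !mxE.
split.
- rewrite (sE ord_max) /= addnn -mul2n exprM sqrrN !expr1n mul1r.
  by congr (\det _); apply/matrixP => i l; rewrite !mxE /bump leqNgt ltn_ord.
- have := sE (inord n); rewrite inordK // => ->.
  rewrite addSn exprS addnn -mul2n exprM sqrrN !expr1n.
  by rewrite mulr1 mulN1r /D (deriv_det_jets phiS).
- move=> y; rewrite (expand_det_row _ ord0) big_distrr; apply: eq_bigr => j _ /=.
  rewrite mxE /= /s inord_val -mulrA signrMK mulrC.
  by congr (_ * \det _ * _); apply/matrixP => i l; rewrite !mxE.
Qed.

(** * Crum's theorem, with denominators cleared *)

Section Crum.

Variables (R : idomainType) (a kappa : R) (n : nat) (D : {poly R}).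

(** For [D] = Omega, [n.+1] = k and [kappa] = k2, these are Omega h1 and Omega (h0 + u); the
    constant [kappa - n.+1] is -k1. *)
Let H1 : {poly R} := ((a + n.+1%:R + 1)%:P - 'X) * D - 2%:R * 'X * D^`().
Let H0 : {poly R} :=
  (kappa - n.+1%:R)%:P * D + ('X - (a + n.+1%:R)%:P) * D^`() + 'X * D^`(2).

Variable s : nat -> {poly R}.
Hypothesis s_last : s n.+1 = D.
Hypothesis s_prev : s n = - (D^`() + kappa%:P * D).

(* [S1 y] and [S2 y] are the derivatives of [S0 y] when [y] is the sequence of
   derivatives of [y 0]. *)
Let S0 (y : nat -> {poly R}) : {poly R} := \sum_(j < n.+2) s j * y j.
Let S1 (y : nat -> {poly R}) : {poly R} :=
  \sum_(j < n.+2) ((s j)^`() * y j + s j * y j.+1).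
Let S2 (y : nat -> {poly R}) : {poly R} := \sum_(j < n.+2)
  ((s j)^`(2) * y j + 2%:R * (s j)^`() * y j.+1 + s j * y j.+2).

Let deriv_S0 cy (y : nat -> {poly R}) :
    (forall j, y j.+1 = (y j)^`() + cy%:P * y j) ->
  (S0 y)^`() = S1 y - cy%:P * S0 y.
Proof.
move=> yS; rewrite /S0 /S1 raddf_sum big_distrr -sumrB; apply: eq_bigr => j _ /=.
by rewrite derivM yS; ring.
Qed.

Let deriv_S1 cy (y : nat -> {poly R}) :
    (forall j, y j.+1 = (y j)^`() + cy%:P * y j) ->
  (S1 y)^`() = S2 y - cy%:P * S1 y.
Proof.
move=> yS; rewrite /S1 /S2 raddf_sum big_distrr -sumrB; apply: eq_bigr => j _ /=.
by rewrite derivD !derivM (yS j.+1) (yS j); ring.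
Qed.

(* The coefficients [H1] and [H0] are exactly those for which the terms of order
   [n.+1] and more cancel. *)
Let low_order : exists e : nat -> {poly R}, forall y : nat -> {poly R},
  'X * D * S2 y + H1 * S1 y + H0 * S0 y
  - D * \sum_(j < n.+2) s j * ('X * y j.+2 + ((a + 1 + j%:R)%:P - 'X) * y j.+1
                                - j%:R%:P * y j)
  = \sum_(j < n.+1) e j * y j.
Proof.
(* The terms in [y j.+2] cancel for each [j]; [A j] and [B j] are the remaining coefficients of
   [y j] and [y j.+1]. Thus [Bn] removes order [n.+2] and [AB] order [n.+1]. *)
pose A j := 'X * D * (s j)^`(2) + H1 * (s j)^`() + H0 * s j + D * s j * j%:R%:P.
pose B j := 2%:R * 'X * D * (s j)^`() + H1 * s j
  - D * s j * ((a + 1 + j%:R)%:P - 'X).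
have Bn : B n.+1 = 0 by rewrite /B /H1 s_last; ring.
have AB : A n.+1 + B n = 0.
  rewrite /A /B s_last s_prev !(derivnS, derivn1, derivn0).
  rewrite /H0 /H1 derivN derivD derivM derivC.
  by rewrite -!natr1; ring.
exists (fun j => A j + if j is j'.+1 then B j' else 0) => y.
rewrite /S0 /S1 /S2 !big_distrr -!big_split -sumrB /=.
transitivity (\sum_(j < n.+2) A j * y j + \sum_(j < n.+2) B j * y j.+1).
  by rewrite -big_split; apply: eq_bigr => j _ /=; rewrite /A /B; ring.
rewrite [X in X + _]big_ord_recr [X in _ + X]big_ord_recr /= Bn mul0r addr0.
rewrite [X in _ + X]big_ord_recr /= addrACA -mulrDl AB mul0r addr0.
under [RHS]eq_bigr do rewrite mulrDl; rewrite big_split /=; congr (_ + _).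
by rewrite big_ord_recl mul0r add0r.
Qed.

Variables (c lam : nat -> R) (phi : nat -> nat -> {poly R}).
Hypothesis phi_jet : forall i, (i < n.+1)%N -> eigenjet a (c i) (lam i) (phi i).
Hypothesis D_det : D = \det (jets_mx phi n.+1).
Hypothesis D0 : D != 0.
Hypothesis s_phi : forall i, (i < n.+1)%N -> \sum_(j < n.+2) s j * phi i j = 0.

Lemma crum_ode mu (y : nat -> {poly R}) (Y := \sum_(j < n.+2) s j * y j) :
    eigenjet a 0 mu y ->
  'X * D * Y^`(2) + H1 * Y^`() + H0 * Y = mu%:P * D * Y.
Proof.
have [e eE] := low_order.
(* Stated for every [cy]: it is applied to the [phi i], to show that [e] vanishes, and then to [y],
   where [cy] is 0. *)
have {eE}eE cy lamy y' : eigenjet a cy lamy y' ->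
    'X * D * S2 y' + H1 * S1 y' + H0 * S0 y' - lamy%:P * D * S0 y'
    = \sum_(j < n.+1) e j * y' j.
  move=> [_ yD]; rewrite -eE; congr (_ - _); rewrite mulrAC mulrC.
  congr (_ * _); rewrite /S0 big_distrr.
  by apply: eq_bigr => j _; rewrite yD /=; ring.
have e0 (j : 'I_n.+1) : e j = 0.
  move: j; move: D0; rewrite D_det => /det_neq0_col_free; apply=> i.
  have S0i : S0 (phi i) = 0 by exact: s_phi.
  have [phiS _] := phi_jet (ltn_ord i).
  have S1i : S1 (phi i) = 0.
    by have := deriv_S0 phiS; rewrite S0i linear0 mulr0 subr0.
  have S2i : S2 (phi i) = 0.
    by have := deriv_S1 phiS; rewrite S1i linear0 mulr0 subr0.
  under eq_bigr do rewrite mxE.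
  by rewrite -(eE _ _ _ (phi_jet (ltn_ord i))) S0i S1i S2i !mulr0 !addr0 subr0.
move=> yjet; have := eE _ _ _ yjet; rewrite big1 => [|j _]; last first.
  by rewrite e0 mul0r.
have [yS _] := yjet; move/eqP; rewrite subr_eq0 => /eqP <-.
have Y1 : Y^`() = S1 y by rewrite (deriv_S0 yS) polyC0 mul0r subr0.
have Y2 : Y^`(2) = S2 y.
  by rewrite derivnS derivn1 Y1 (deriv_S1 yS) polyC0 mul0r subr0.
by rewrite Y1 Y2.
Qed.

End Crum.

(** * Laguerre polynomials and their jets *)

Section Laguerre.

Variable R : realType.
Implicit Types (a : R) (n j : nat).

Lemma rbinomS a m : (m.+1)%:R * rbinom a m.+1 = (a - m%:R) * rbinom a m.
Proof.
rewrite /rbinom big_ord_recr /= factS natrM; field.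
by rewrite nat1r !pnatr_eq0 -lt0n fact_gt0.
Qed.

Lemma rbinom_pascal a m : rbinom (a + 1) m.+1 = rbinom a m.+1 + rbinom a m.
Proof.
have prodS : \prod_(i < m.+1) (a + 1 - i%:R) = (a + 1) * \prod_(i < m) (a - i%:R).
  rewrite big_ord_recl subr0; congr (_ * _); apply: eq_bigr => i _.
  by rewrite lift0 -natr1; ring.
rewrite /rbinom prodS big_ord_recr /= factS natrM; field.
by rewrite nat1r !pnatr_eq0 -lt0n fact_gt0.
Qed.

Lemma coef_laguerre a n j : (laguerre a n)`_j =
  if (j <= n)%N then (-1) ^+ j / (j`!)%:R * rbinom (n%:R + a) (n - j) else 0.
Proof.
have cXN i : ((- 'X : {poly R}) ^+ i)`_j = if i == j then (-1) ^+ j else 0.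
  have -> : (- 'X : {poly R}) ^+ i = ((-1) ^+ i)%:P * 'X^i.
    by rewrite [LHS]exprNn polyC_exp polyCN.
  rewrite coefCM coefXn eq_sym.
  by case: eqP => [->|_]; rewrite ?mulr1 ?mulr0.
rewrite /laguerre coef_sum; under eq_bigr do rewrite coefZ cXN.
have [jn|nj] := leqP j n.
  rewrite (bigD1 (Ordinal (jn : j < n.+1)%N)) //= eqxx big1 => [|i].
    by rewrite addr0; ring.
  by rewrite -val_eqE /= => /negPf ->; rewrite mulr0.
by rewrite big1 // => i _; rewrite ltn_eqF ?mulr0 // (leq_trans (ltn_ord i)).
Qed.

Lemma laguerre_neq0 a n : laguerre a n != 0.
Proof.
apply/eqP => /(congr1 (fun p : {poly R} => p`_n)) /eqP.
rewrite coef_laguerre leqnn subnn /rbinom big_ord0 coef0 divr1 mulr1.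
by rewrite mulf_eq0 signr_eq0 invr_eq0 pnatr_eq0 eqn0Ngt fact_gt0.
Qed.

(** Pascal's rule on coefficients. It trades a shift of the parameter for a derivative, which makes
    the shifted rows jets with [c] = 1. *)
Lemma laguerreD1 a n : laguerre (a + 1) n = laguerre a n - (laguerre a n)^`().
Proof.
apply/polyP => j; rewrite coefB coef_deriv !coef_laguerre.
have [jn|nj|->] := ltngtP j n; last 1 first.
- by rewrite subnn /rbinom !big_ord0 mul0rn subr0.
- rewrite addrA -[in LHS](subnSK jn) rbinom_pascal (subnSK jn).
  rewrite factS natrM exprS -mulr_natr; field.
  by rewrite nat1r !pnatr_eq0 -lt0n fact_gt0.
- by rewrite mul0rn subr0.
Qed.

Lemma laguerre_ode a n (L := laguerre a n) :
  'X * L^`(2) + ((a + 1)%:P - 'X) * L^`() = (- n%:R)%:P * L.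
Proof.
apply/polyP => j; rewrite coefD mulrBl coefB !coefXM !coefCM.
(* The coefficient of x^j in the equation, after moving the term in [j] to the right. *)
suff: (j.+1)%:R * (j.+1%:R + a) * L`_j.+1 = (j%:R - n%:R) * L`_j.
  case: j => [|j] /= E; rewrite !coef_deriv.
    by apply: etrans (etrans E _); ring.
  have /= {}E := congr1 (fun u => u - j.+1%:R * L`_j.+1) E.
  by apply: etrans (etrans E _); ring.
rewrite /L !coef_laguerre; have [jn|nj|->] := ltngtP j n; last 1 first.
- by rewrite subrr mulr0 mul0r.
- have := rbinomS (n%:R + a) (n - j.+1); rewrite (subnSK jn) => E.
  have {1}-> : j%:R - n%:R = - (n - j)%:R :> R by rewrite natrB 1?ltnW // opprB.
  rewrite mulNr [in RHS]mulrCA E natrB // factS natrM exprS; field.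
  by rewrite nat1r !pnatr_eq0 -lt0n fact_gt0.
- by rewrite !mulr0.
Qed.

Lemma wronskian_row_eigenjet a f : eigenjet a 0 (- f%:R) (wronskian_row a f).
Proof.
apply: eigenjet_from0 => [j|]; first by rewrite polyC0 mul0r addr0.
exact: laguerre_ode.
Qed.

Lemma shifted_row_eigenjet a f : eigenjet a 1 (a + 1 + f%:R) (shifted_row a f).
Proof.
have rS j : shifted_row a f j.+1 =
    (shifted_row a f j)^`() + 1%:P * shifted_row a f j.
  rewrite /shifted_row -natr1 addrA laguerreD1 deriv_comp derivN derivX.
  by rewrite comp_polyB polyC1; ring.
apply: eigenjet_from0 => //; set r := shifted_row a f.
have /(congr1 (fun p => p \Po (- 'X))) := laguerre_ode a f.
rewrite !(comp_polyB, comp_polyD, comp_polyM, comp_polyC, comp_polyX).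
(* The derivatives of L_f at -x in terms of the jet: since d acts on [r] as the shift minus 1, L_f'
   becomes minus that operator and L_f'' its square. *)
have r0 : laguerre a f \Po (- 'X) = r 0 by rewrite /r /shifted_row addr0.
have r1 : (laguerre a f)^`() \Po (- 'X) = r 0 - r 1.
  rewrite /r rS -/r -r0 deriv_comp derivN derivX polyC1; ring.
have r2 : (laguerre a f)^`(2) \Po (- 'X) = r 2 - 2%:R * r 1 + r 0.
  have := congr1 deriv r1; rewrite deriv_comp derivN derivX derivB => E.
  have dr j : (r j)^`() = r j.+1 - r j by rewrite /r rS polyC1 mul1r addrK.
  by apply: oppr_inj; rewrite -[LHS]mulrN1 [LHS]E !dr; ring.
rewrite r0 r1 r2 => E; apply/eqP; rewrite -subr_eq0; apply/eqP.
move/eqP: E; rewrite -subr_eq0 => /eqP/(congr1 -%R); rewrite oppr0 => E.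
by rewrite -[RHS]E; ring.
Qed.

End Laguerre.

(** * The two families of rows as a single list of eigenjets *)

Definition seed_row (R : realType) (a : R) (p : bool * nat) :=
  if p.1 then shifted_row a p.2 else wronskian_row a p.2.

Definition seed_eigenvalue (R : realType) (a : R) (p : bool * nat) : R :=
  if p.1 then a + 1 + p.2%:R else - p.2%:R.

Definition seeds (F : fpair) : seq (bool * nat) :=
  [seq (false, f) | f <- sort leq F.1] ++ [seq (true, f) | f <- sort leq F.2].

Section Seeds.

Variables (R : realType) (a : R).

(** Read as a number, the Boolean of a seed is the exponent [c] of its exponential factor. *)
Lemma seed_row_eigenjet (p : bool * nat) :
  eigenjet a p.1%:R (seed_eigenvalue a p) (seed_row a p).
Proof.
case: p => [[] f]; first exact: shifted_row_eigenjet.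
exact: wronskian_row_eigenjet.
Qed.

Lemma seed_row_neq0 p : seed_row a p 0 != 0.
Proof.
case: p => [[] f]; rewrite /seed_row /=; last exact: laguerre_neq0.
rewrite /shifted_row addr0; apply: contraNneq (laguerre_neq0 a f) => /eqP.
by rewrite comp_poly_eq0 // size_polyN size_polyX.
Qed.

(** Eigenvalues of different families could meet only if [a] = -(f + f' + 1), which is excluded. *)
Lemma seed_eigenvalue_inj :
  (forall m : nat, a <> - (m.+1)%:R) -> injective (seed_eigenvalue a).
Proof.
move=> ha [b f] [b' f']; rewrite /seed_eigenvalue /=.
have ne i j : a + 1 + i%:R <> - j%:R.
  move=> E; apply: (ha (i + j)%N).
  by rewrite -natr1 natrD -[a](addrK (1 + i%:R)) addrA E; ring.
case: b b' => [] [] E.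
- by move/addrI/eqP: E; rewrite eqr_nat => /eqP ->.
- by case: (ne f f').
- by case: (ne f' f).
- by move/oppr_inj/eqP: E; rewrite eqr_nat => /eqP ->.
Qed.

Lemma det_rows_seeds m (s : seq (bool * nat)) : size s = m ->
  det_rows m [seq seed_row a p | p <- s]
    = \det (jets_mx (fun i => seed_row a (nth (false, 0%N) s i)) m).
Proof.
move=> <-; congr (\det _); apply/matrixP => i j.
by rewrite !mxE (nth_map (false, 0%N)).
Qed.

(** An arbitrary duplicate-free list covers both [OmegaF] and [laguerreF], the latter having one
    more seed. *)
Lemma det_rows_seeds_neq0 m (s : seq (bool * nat)) :
    (forall m : nat, a <> - (m.+1)%:R) -> size s = m -> uniq s ->
  det_rows m [seq seed_row a p | p <- s] != 0.
Proof.
move=> ha sm us; rewrite det_rows_seeds //.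
pose c i : R := (nth (false, 0%N) s i).1%:R.
pose lam i := seed_eigenvalue a (nth (false, 0%N) s i).
pose phi i := seed_row a (nth (false, 0%N) s i).
apply: (@det_eigenjets_neq0 R a c lam phi) => [i _|i _|i j].
- exact: seed_row_eigenjet.
- exact: seed_row_neq0.
rewrite !inE => im jm /(seed_eigenvalue_inj ha)/eqP.
by rewrite nth_uniq ?sm // => /eqP.
Qed.

End Seeds.

Lemma rowsF_seeds (R : realType) (a : R) F :
  rowsF a F = [seq seed_row a p | p <- seeds F].
Proof. by rewrite /rowsF /seeds map_cat -!map_comp. Qed.

Lemma size_seeds F : size (seeds F) = kF F.
Proof. by rewrite size_cat !size_map !size_sort. Qed.

Lemma mem_seeds F b f : ((b, f) \in seeds F) = (f \in if b then F.2 else F.1).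
Proof.
rewrite mem_cat; case: b.
  rewrite [X in X || _](_ : _ = false) ?mem_map ?mem_sort //; first by move=> ? ? [].
  by apply/negP => /mapP[].
rewrite [X in _ || X](_ : _ = false) ?orbF ?mem_map ?mem_sort //.
  by move=> ? ? [].
by apply/negP => /mapP[].
Qed.

Lemma uniq_seeds F : uniq (seeds F).
Proof.
rewrite cat_uniq !map_inj_uniq ?sort_uniq ?fset_uniq ?andbT; try by move=> ? ? [].
by apply/hasPn => _ /mapP[f _ ->]; apply/negP => /mapP[].
Qed.

(** This identifies the constant [kappa] of Crum's theorem with k2. *)
Lemma sum_seeds (R : realType) F m : kF F = m ->
  \sum_(i < m) (nth (false, 0%N) (seeds F) i).1%:R = (#|` F.2|)%:R :> R.
Proof.
rewrite -size_seeds => <-.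
rewrite -(big_mkord xpredT (fun i => (nth (false, 0%N) (seeds F) i).1%:R)).
rewrite -(big_nth (false, 0%N) xpredT (fun p : bool * nat => p.1%:R)).
rewrite big_cat !big_map /=.
by rewrite big1 // add0r -natr_sum sum1_size size_sort.
Qed.

(** * Division by Omega and assembly of the eigenvalue equation *)

Lemma ode_normalize (K : fieldType) (x d d1 d2 y y1 y2 A B C e : K) :
    d != 0 ->
    x * d * y2 + (A * d - 2%:R * x * d1) * y1 + (B * d + C * d1 + x * d2) * y
      = e * d * y ->
  x * y2 + (A - 2%:R * x * (d1 / d)) * y1
    + (B + C * (d1 / d) + x * (d2 / d)) * y = e * y.
Proof.
move=> d0 ode; apply: (mulfI d0); rewrite [RHS]mulrCA [RHS]mulrA -ode.
by field.
Qed.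

Lemma tofrac_ode (R : realType) (D D1 D2 L L1 L2 A B C : {poly R}) (E : R) :
    D != 0 ->
    'X * D * L2 + (A * D - 2%:R * 'X * D1) * L1 + (B * D + C * D1 + 'X * D2) * L
      = E%:P * D * L ->
  'X%:F * L2%:F + (A%:F - 2%:R * 'X%:F * (D1%:F / D%:F)) * L1%:F
    + (B%:F + C%:F * (D1%:F / D%:F) + 'X%:F * (D2%:F / D%:F)) * L%:F
  = (E *: L)%:F.
Proof.
rewrite -tofrac_eq0 => D0 /(congr1 (@FracField.tofrac _)).
rewrite -mul_polyC !(tofracD, tofracB, tofracM, tofracN, tofrac1) => ode.
exact: ode_normalize D0 ode.
Qed.

Theorem theorem5p2 (R : realType) (alpha : R) (F : fpair)
    (halpha : forall m : nat, alpha <> - (m.+1)%:R)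
    (hF1 : forall f : nat, f \in F.1 -> (0 < f)%N)
    (hF2 : forall f : nat, f \in F.2 -> (0 < f)%N)
    (hF : ~ (F.1 = fset0 /\ F.2 = fset0)) :
  OmegaF alpha F != 0 /\
  forall n : nat, n \in sigmaF F ->
    is_eigenfunction (DF alpha F) (- n%:R) (laguerreF alpha F n).
Proof.
have Om0 : OmegaF alpha F != 0.
  by rewrite /OmegaF rowsF_seeds det_rows_seeds_neq0 ?size_seeds ?uniq_seeds.
split=> // n /andP[un nF1]; split.
  rewrite /laguerreF rowsF_seeds.
  (* Membership of [n] in [sigmaF F] says exactly that the seed for L_(n-u) is new. *)
  apply: (@det_rows_seeds_neq0 R alpha _ ((false, n - uF F)%N :: seeds F)) => //=.
    by rewrite size_seeds.
  rewrite uniq_seeds andbT mem_seeds; apply: contra nF1 => nF1.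
  by apply/imfsetP; exists (n - uF F)%N; rewrite //= subnKC.
apply: tofrac_ode => //.
(* With k positive, the next-to-last coefficient [s m] exists. *)
have [m km] : exists m, kF F = m.+1.
  exists (kF F).-1; rewrite prednK // lt0n /kF addn_eq0 !cardfs_eq0.
  by apply/negP => /andP[/eqP F1 /eqP F2]; apply: hF.
pose phi i := seed_row alpha (nth (false, 0%N) (seeds F) i).
pose c i : R := (nth (false, 0%N) (seeds F) i).1%:R.
have phi_jet i : eigenjet alpha (c i) _ (phi i) := seed_row_eigenjet alpha _.
have OmE : OmegaF alpha F = \det (jets_mx phi m.+1).
  by rewrite /OmegaF rowsF_seeds km (det_rows_seeds _ (m := m.+1)) // size_seeds.
have LE : laguerreF alpha F n =
    \det (jets_mx (bordered (wronskian_row alpha (n - uF F)) phi) m.+2).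
  rewrite /laguerreF rowsF_seeds km; congr (\det _).
  apply/matrixP => -[[|i] im] j; rewrite !mxE //=.
  by rewrite (nth_map (false, 0%N)) // size_seeds km.
have [|s [s_last s_prev sE]] := @det_bordered R c phi m.
  by move=> i j _; exact: (phi_jet i).1.
(* Bordering by a row already present gives two equal rows. *)
have s_phi i : (i < m.+1)%N -> \sum_(j < m.+2) s j * phi i j = 0.
  move=> im; have /eqP := sE (phi i).
  rewrite (@determinant_alternate _ _ _ ord0 (lift ord0 (Ordinal im))) //.
    by rewrite eq_sym mulf_eq0 signr_eq0 => /eqP.
  by move=> j; rewrite !mxE lift0.
rewrite -OmE in s_last s_prev; rewrite sum_seeds // in s_prev.
have := crum_ode s_last s_prev (fun i _ => phi_jet i) OmE Om0 s_phi
  (wronskian_row_eigenjet alpha (n - uF F)).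
rewrite LE sE -km; move: (\sum_(j < _) _) (OmegaF _ _) => Y D ode.
have deriv_sign (p : {poly R}) :
    ((-1) ^+ kF F * p)^`() = (-1) ^+ kF F * p^`().
  by rewrite -signr_odd; case: odd; rewrite ?mulN1r ?mul1r ?derivN.
rewrite /= !deriv_sign.
(* Crum's equation has eigenvalue -(n - u) and constant -k1; subtracting u D Y turns them into -n
   and -k1 - u. The sign is that of the expansion of [laguerreF]. *)
have /= {}ode := congr1 (fun p => (-1) ^+ kF F * (p - (uF F)%:R%:P * D * Y)) ode.
rewrite (natrB _ un) in ode; move: (uF F) ode => u ode.
by apply: etrans (etrans ode _); rewrite ?/kF ?natrD; ring.
Qed.
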